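(* Let $T$ be a bounded linear operator on a complex Hilbert space $\mathcal{H}$ which is $k$-quasiparanormal for some positive integer $k$. (a) Suppose $T$ is invertible. Then (a$_1$) $T$ and $T^{-1}$ are paranormal (and hence $k$-quasiparanormal for every positive integer $k$); and (a$_2$) if one of $T^n$ or $T^{-n}$ is quasinormal for some positive integer $n$, then so is the other, and $T$ and $T^{-1}$ are normal. (b) More generally, if $T$ has dense range and $T^n$ is quasinormal for some positive integer $n$, then $T$ is normal.
   Context: $T$ is paranormal if $\|Tx\|^2\le\|T^2x\|\,\|x\|$ for every $x\in\mathcal{H}$. $T$ is $k$-quasiparanormal if $\|T(T^kx)\|^2\le\|T^2(T^kx)\|\,\|T^kx\|$ for every $x\in\mathcal{H}$. An operator $A$ is quasinormal if $(A^*A-AA^* )A=O$. *)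

(* Defs.v *)
(* complex Hilbert spaces set up by hand over C := R[i], R : realType. *)
From HB Require Import structures.
From mathcomp Require Import all_boot all_order all_algebra.
From mathcomp Require Import complex.
From mathcomp Require Import reals.
Set Implicit Arguments. Unset Strict Implicit. Unset Printing Implicit Defensive.
Import Order.TTheory GRing.Theory Num.Theory.
Local Open Scope ring_scope.

Section Hilbert.
Variables (R : realType) (V : lmodType R[i]) (ip : V -> V -> R[i]).

(* ip is a (complex) inner product: linear in the first argument,
   conjugate symmetric, positive definite. *)
Definition is_inner_product : Prop :=
  [/\ (forall (a : R[i]) (x y z : V), ip (a *: x + y) z = a * ip x z + ip y z),
      (forall x y : V, ip y x = (ip x y)^*),
      (forall x : V, 0 <= ip x x) &
      (forall x : V, ip x x = 0 -> x = 0)].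

(* induced norm ||x|| = sqrt (Re <x,x>) *)
Definition ipnorm (x : V) : R := Num.sqrt (complex.Re (ip x x)).

(* completeness of the induced metric: every Cauchy sequence converges *)
Definition ip_complete : Prop :=
  forall u : nat -> V,
    (forall e : R, 0 < e -> exists N, forall m n, (N <= m)%N -> (N <= n)%N ->
        ipnorm (u m - u n) < e) ->
    exists l : V, forall e : R, 0 < e -> exists N, forall n, (N <= n)%N ->
        ipnorm (u n - l) < e.

(* complex Hilbert space structure on V *)
Definition hilbert : Prop := is_inner_product /\ ip_complete.

Definition linear_op (T : V -> V) : Prop :=
  forall (a : R[i]) (x y : V), T (a *: x + y) = a *: T x + T y.

Definition bounded_op (T : V -> V) : Prop :=
  linear_op T /\ exists M : R, forall x, ipnorm (T x) <= M * ipnorm x.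

(* B is the (Hilbert) adjoint of A *)
Definition is_adjoint (A B : V -> V) : Prop :=
  forall x y : V, ip (A x) y = ip x (B y).

Definition opow (T : V -> V) (n : nat) : V -> V := iter n T.

Definition paranormal (T : V -> V) : Prop :=
  forall x, ipnorm (T x) ^+ 2 <= ipnorm (T (T x)) * ipnorm x.

Definition k_quasiparanormal (k : nat) (T : V -> V) : Prop :=
  forall x, ipnorm (T (opow T k x)) ^+ 2 <=
    ipnorm (T (T (opow T k x))) * ipnorm (opow T k x).

(* quasinormal: (A^* A - A A^* ) A = 0 *)
Definition quasinormal (A : V -> V) : Prop :=
  exists B, is_adjoint A B /\ forall x, B (A (A x)) - A (B (A x)) = 0.

(* normal: A^* A = A A^* *)
Definition normal_op (A : V -> V) : Prop :=
  exists B, is_adjoint A B /\ forall x, B (A x) = A (B x).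

(* S is a bounded two-sided inverse of T, i.e. T invertible in B(H) with T^{-1} = S *)
Definition is_inverse (T S : V -> V) : Prop :=
  bounded_op S /\ (forall x, S (T x) = x) /\ (forall x, T (S x) = x).

Definition dense_range (T : V -> V) : Prop :=
  forall (x : V) (e : R), 0 < e -> exists y, ipnorm (x - T y) < e.

End Hilbert.

(* Main.v *)
(* Quasi-paranormality passes to paranormality by density of the range of T^k,
   and N = T^n is normal, again by density. For paranormal or normal operators
   |T^j x| is log-convex in j. The vectors x with |N^m x| = O(r^m) form a closed
   subspace on which |N x| <= r |x|, and |N x| >= r |x| on its orthogonal
   complement: these play the role of the spectral subspaces of N^*N. Since
   |N^m x| = |N^*m x|, they are invariant under both T and T^*. On the part where
   c^n |x| <= |N x| <= d^n |x|, with d - c = h, log-convexity gives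
   |T x|, |T^* x| <= d |x|, and factoring N through T (or N^* through T^* ) gives
   |T x|, |T^* x| >= (d - n h) |x|. Splitting the space orthogonally into such parts
   and letting h -> 0 yields |T x| = |T^* x|. All of this uses only the real inner
   product Re <x, y>. *)
Require Import Defs.
From HB Require Import structures.
From mathcomp Require Import all_boot all_order all_algebra.
From mathcomp Require Import complex.
From mathcomp Require Import reals.
From mathcomp Require Import boolp classical_sets ring lra.
Set Implicit Arguments. Unset Strict Implicit. Unset Printing Implicit Defensive.
Import Order.TTheory GRing.Theory Num.Theory.
Local Open Scope ring_scope.

(** * Elementary identities for linear maps *)

Section LinearMaps.
Variables (K : nzRingType) (U : lmodType K).

Lemma linD (T : U -> U) x y : linear T -> T (x + y) = T x + T y.
Proof. by move=> Tl; rewrite -[x]scale1r Tl !scale1r. Qed.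

Lemma lin0 (T : U -> U) : linear T -> T 0 = 0.
Proof. by move=> Tl; apply: (addIr (T 0)); rewrite -linD// !add0r. Qed.

Lemma linZ (T : U -> U) a x : linear T -> T (a *: x) = a *: T x.
Proof. by move=> Tl; rewrite -[_ *: x]addr0 Tl lin0// addr0. Qed.

Lemma linB (T : U -> U) x y : linear T -> T (x - y) = T x - T y.
Proof. by move=> Tl; rewrite linD// -scaleN1r linZ// scaleN1r. Qed.

Lemma lin_iter (T : U -> U) m : linear T -> linear (iter m T).
Proof. by move=> Tl; elim: m => [|m IHm] a x y //=; rewrite IHm Tl. Qed.

End LinearMaps.

(** * Real Hilbert spaces: nearest points, projections, Riesz representation, adjoints *)

Section RealInnerProduct.
Variables (R : realType) (V : lmodType R) (f : V -> V -> R).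

Definition real_ip : Prop :=
  [/\ (forall a x y z, f (a *: x + y) z = a * f x z + f y z),
      (forall x y, f x y = f y x),
      (forall x, 0 <= f x x) &
      (forall x, f x x = 0 -> x = 0)].

Definition rnorm (x : V) : R := Num.sqrt (f x x).

Local Notation nrm := rnorm.

Definition complete_nrm : Prop :=
  forall u : nat -> V,
    (forall e : R, 0 < e -> exists N, forall m n, (N <= m)%N -> (N <= n)%N ->
        nrm (u m - u n) < e) ->
    exists l : V, forall e : R, 0 < e -> exists N, forall n, (N <= n)%N ->
        nrm (u n - l) < e.

Definition bounded (T : V -> V) : Prop :=
  exists2 M : R, 0 <= M & forall x, nrm (T x) <= M * nrm x.

Definition adjoint (A B : V -> V) : Prop := forall x y, f (A x) y = f x (B y).

Definition closed_set (C : V -> Prop) : Prop :=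
  forall x, (forall e, 0 < e -> exists2 z, C z & nrm (x - z) < e) -> C x.

Hypothesis Hf : real_ip.

Lemma fC x y : f x y = f y x. Proof. by case: Hf. Qed.
Lemma fxx_ge0 x : 0 <= f x x. Proof. by case: Hf. Qed.
Lemma fDl x y z : f (x + y) z = f x z + f y z.
Proof. by case: Hf => /(_ 1 x y z); rewrite scale1r mul1r. Qed.
Lemma f0l z : f 0 z = 0.
Proof. by apply: (addIr (f 0 z)); rewrite -fDl !add0r. Qed.
Lemma fZl a x z : f (a *: x) z = a * f x z.
Proof. by case: Hf => /(_ a x 0 z); rewrite f0l !addr0. Qed.
Lemma fNl x z : f (- x) z = - f x z.
Proof. by rewrite -scaleN1r fZl mulN1r. Qed.
Lemma fDr x y z : f x (y + z) = f x y + f x z.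
Proof. by rewrite fC fDl !(fC x). Qed.
Lemma fZr a x z : f x (a *: z) = a * f x z.
Proof. by rewrite fC fZl fC. Qed.
Lemma fNr x z : f x (- z) = - f x z.
Proof. by rewrite fC fNl fC. Qed.
Lemma f0r z : f z 0 = 0. Proof. by rewrite fC f0l. Qed.

Definition fE := (fDl, fDr, fNl, fNr, fZl, fZr).

Lemma fxx_eq0 x : f x x = 0 -> x = 0. Proof. by case: Hf => _ _ _; apply. Qed.

Lemma eq_of_f x y : (forall z, f z x = f z y) -> x = y.
Proof.
move=> h; apply/eqP; rewrite -subr_eq0; apply/eqP/fxx_eq0.
by rewrite fDr fNr h subrr.
Qed.

Lemma nrm_ge0 x : 0 <= nrm x. Proof. exact: sqrtr_ge0. Qed.
Lemma sqr_nrm x : nrm x ^+ 2 = f x x. Proof. by rewrite sqr_sqrtr ?fxx_ge0. Qed.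
Lemma nrm0 : nrm 0 = 0. Proof. by rewrite /rnorm f0l sqrtr0. Qed.
Lemma nrm_eq0 x : nrm x = 0 -> x = 0.
Proof. by move=> h; apply: fxx_eq0; rewrite -sqr_nrm h expr0n. Qed.
Lemma nrmN x : nrm (- x) = nrm x. Proof. by rewrite /rnorm fNl fNr opprK. Qed.
Lemma nrmB x y : nrm (x - y) = nrm (y - x). Proof. by rewrite -nrmN opprB. Qed.
Lemma nrmZ a x : nrm (a *: x) = `|a| * nrm x.
Proof. by rewrite /rnorm fZl fZr mulrA -expr2 sqrtrM ?sqr_ge0// sqrtr_sqr. Qed.

(** Near [t = 0] the linear term dominates, so a nonzero [b] would produce a negative value. This is
    the first-order condition at a nearest point. *)
Lemma quad_ge0 (b c : R) : (forall t, 0 <= 2 * t * b + t ^+ 2 * c) -> b = 0.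
Proof.
move=> h; apply/eqP/negPn/negP => b0.
have b2 : 0 < b ^+ 2 by rewrite exprn_even_gt0.
have q0 : 0 < `|c| + 1 by rewrite ltr_wpDl.
(* The shift by 1 keeps the denominator positive when [c = 0]; the value is negative because c <
   2(|c| + 1). *)
have := h (- b / (`|c| + 1)).
have -> : 2 * (- b / (`|c| + 1)) * b + (- b / (`|c| + 1)) ^+ 2 * c =
   (b ^+ 2 / (`|c| + 1) ^+ 2) * (c - 2 * (`|c| + 1)) by field; rewrite gt_eqF.
rewrite pmulr_rge0; first by have := ler_norm c; lra.
by rewrite divr_gt0// exprn_gt0.
Qed.

Lemma cauchy_schwarz x y : f x y <= nrm x * nrm y.
Proof.
have [y0|y0] := eqVneq (nrm y) 0.
  by rewrite (nrm_eq0 y0) f0r nrm0 mulr0.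
have yp : 0 < nrm y by rewrite lt0r y0 nrm_ge0.
have [x0|x0] := eqVneq (nrm x) 0.
  by rewrite (nrm_eq0 x0) f0l nrm0 mul0r.
have xp : 0 < nrm x by rewrite lt0r x0 nrm_ge0.
have := fxx_ge0 (nrm y *: x - nrm x *: y).
rewrite !fE -!sqr_nrm (fC y x) => h.
have : 0 <= (2 * nrm x * nrm y) * (nrm x * nrm y - f x y) by nra.
by rewrite pmulr_rge0 ?subr_ge0 // !mulr_gt0.
Qed.

Lemma nrmD x y : nrm (x + y) <= nrm x + nrm y.
Proof.
rewrite -(@ler_pXn2r _ 2) ?nnegrE ?addr_ge0 ?nrm_ge0//.
rewrite sqr_nrm !fE -!sqr_nrm (fC y x).
by have := cauchy_schwarz x y; nra.
Qed.

Lemma nrm_subl x y : nrm x <= nrm (x - y) + nrm y.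
Proof. by have := nrmD (x - y) y; rewrite subrK. Qed.

Lemma pythag x y : f x y = 0 -> f (x + y) (x + y) = f x x + f y y.
Proof. by move=> h; rewrite !fE (fC y x) h; ring. Qed.

Lemma parallelogram x y z :
  f (x - y) (x - y) = 2 * f (z - x) (z - x) + 2 * f (z - y) (z - y)
   - 4 * f (z - 2^-1 *: (x + y)) (z - 2^-1 *: (x + y)).
Proof.
by rewrite !fE (fC y x) (fC x z) (fC y z); lra.
Qed.

Lemma inv_lt (e : R) : 0 < e -> exists N, forall n, (N <= n)%N -> n.+1%:R^-1 < e.
Proof.
move=> e0; exists (Num.bound e^-1) => n Nn.
rewrite invf_plt ?posrE ?ltr0n//.
apply: lt_le_trans (archi_boundP _) _; first by rewrite invr_ge0 ltW.
by rewrite ler_nat (leq_trans Nn).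
Qed.

(** Packages passages to the limit: an error linear in [e] suffices, and [e <= 1] lets higher powers
    of [e] be absorbed. *)
Lemma le_of_le_eps (x y M : R) : 0 <= M ->
  (forall e, 0 < e -> e <= 1 -> x <= y + M * e) -> x <= y.
Proof.
move=> M0 h; apply/ler_addgt0Pr => e e0.
pose d := Num.min 1 (e / (M + 1)).
have M1 : 0 < M + 1 by lra.
have d0 : 0 < d by rewrite lt_min ltr01 divr_gt0.
apply: le_trans (h d d0 _) _; first by rewrite ge_min lexx.
rewrite lerD2l; apply: (@le_trans _ _ ((M + 1) * d)).
  by rewrite ler_pM2r//; lra.
by rewrite mulrC -ler_pdivlMr// ge_min lexx orbT.
Qed.

Hypothesis Hc : complete_nrm.

(* The nearest points to [y] in a decreasing sequence of convex sets form a
   Cauchy sequence, by the parallelogram law. *)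
Lemma nested_nearest (C : nat -> V -> Prop) (y : V) (D : R) :
  (forall m x, C m.+1 x -> C m x) ->
  (forall m x z, C m x -> C m z -> C m (2^-1 *: (x + z))) ->
  (forall m, closed_set (C m)) ->
  (forall m, exists2 x, C m x & f (y - x) (y - x) <= D) ->
  exists2 p, forall m, C m p &
    forall e, 0 < e -> exists m, forall z, C m z ->
      f (y - p) (y - p) <= f (y - z) (y - z) + e.
Proof.
move=> Cdec Cmid Ccl Cne.
have Cle m n x : (m <= n)%N -> C n x -> C m x.
  elim: n => [|n IHn]; first by rewrite leqn0 => /eqP ->.
  by rewrite leq_eqVlt => /predU1P[-> //|]; rewrite ltnS => /IHn h /Cdec /h.
(* [S] collects the lower bounds of the squared distance from [y] on some [C m]; its supremum [d] is
   the limit of the squared distances from [y] to the sets [C m]. *)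
pose S : set R := [set t | exists m, forall z, C m z -> t <= f (y - z) (y - z)]%classic.
have S0 : S 0 by exists 0%N => z _; exact: fxx_ge0.
have Sb : has_sup S.
  split; first by exists 0.
  exists D => t [m h]; have [x Cx] := Cne m; exact: le_trans (h _ Cx).
pose d := sup S.
have d0 : 0 <= d by apply: ub_le_sup => //; case: Sb.
have dl e : 0 < e -> exists m, forall z, C m z -> d - e < f (y - z) (y - z).
  move=> e0; have [t [m h] lt] := sup_adherent e0 Sb.
  by exists m => z /h; exact: lt_le_trans.
have du e m : 0 < e -> exists2 z, C m z & f (y - z) (y - z) < d + e.
  move=> e0; apply: contrapT => h.
  have : S (d + e).
    exists m => z Cz; rewrite leNgt; apply/negP => hlt.
    by apply: h; exists z.
  move/(ub_le_sup (proj2 Sb)); rewrite -/d; lra.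
have j0 j : 0 < j.+1%:R^-1 :> R by rewrite invr_gt0 ltr0n.
have [M HM] := choice (fun j => dl _ (j0 j)).
(* The index [maxn j (M j)] puts [u j] in [C j] and also in [C (M j)], where all squared distances
   exceed [d] minus 1/(j+1). *)
have hu j : exists v, C (maxn j (M j)) v /\ f (y - v) (y - v) < d + j.+1%:R^-1.
  by have [z] := du _ (maxn j (M j)) (j0 j); exists z.
have [u Hu] := choice hu.
have uM j : C (M j) (u j) by apply: Cle (proj1 (Hu j)); exact: leq_maxr.
have uj i j : (i <= j)%N -> C i (u j).
  by move=> ij; apply: Cle (proj1 (Hu j)); rewrite (leq_trans ij) ?leq_maxl.
have [p Hp] : exists p, forall e, 0 < e ->
    exists N, forall n, (N <= n)%N -> nrm (u n - p) < e.
  apply: Hc => e e0.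
  (* With s = 1/(N+1), the parallelogram law bounds the squared gap by 2(d + s) + 2(d + s) - 4(d -
     s) = 8s, hence the 8. *)
  have e8 : 0 < e ^+ 2 / 8 by rewrite divr_gt0// exprn_gt0.
  have [N HN] := inv_lt e8.
  exists N => a b Na Nb.
  rewrite -(@ltr_pXn2r _ 2) ?nnegrE ?nrm_ge0 ?(ltW e0)// sqr_nrm.
  rewrite (parallelogram _ _ y).
  have Dm : d - N.+1%:R^-1 <=
      f (y - 2^-1 *: (u a + u b)) (y - 2^-1 *: (u a + u b)).
    have le c : (N <= c)%N -> d - N.+1%:R^-1 <= d - c.+1%:R^-1.
      by move=> Nc; rewrite lerD2l lerN2 lef_pV2 ?posrE ?ltr0n// ler_nat.
    (* By nesting, both points, hence their midpoint, lie in the set with the smaller index. *)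
    have [ab|/ltnW ab] := leqP (M a) (M b).
      apply: le_trans (le _ Na) (ltW (HM a _ _)).
      by apply: Cmid => //; apply: Cle (uM b).
    apply: le_trans (le _ Nb) (ltW (HM b _ _)).
    by apply: Cmid => //; apply: Cle (uM a).
  have ha := HN _ Na; have hb := HN _ Nb; have hN := HN _ (leqnn N).
  move: (proj2 (Hu a)) (proj2 (Hu b)) ha hb hN Dm => /=.
  move: (a.+1%:R^-1) (b.+1%:R^-1) (N.+1%:R^-1) => *; lra.
exists p.
  move=> m; apply: Ccl => e /Hp [N HN].
  exists (u (maxn m N)); first by apply: uj; rewrite leq_maxl.
  by rewrite nrmB HN// leq_maxr.
have pd : f (y - p) (y - p) <= d.
  have : nrm (y - p) <= Num.sqrt d.
    apply: (@le_of_le_eps _ _ 2) => // e e0 _.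
    have [N HN] := Hp _ e0.
    have [N' HN'] := inv_lt (exprn_gt0 2 e0).
    set n := maxn N N'.
    have h1 := HN n (leq_maxl _ _); have h2 := HN' n (leq_maxr _ _).
    have h3 : nrm (y - u n) <= Num.sqrt d + e.
      rewrite -(@ler_pXn2r _ 2) ?nnegrE ?nrm_ge0 ?addr_ge0 ?sqrtr_ge0 ?(ltW e0)//.
      rewrite sqr_nrm sqrrD sqr_sqrtr//.
      have sde : 0 <= Num.sqrt d * e by rewrite mulr_ge0 ?sqrtr_ge0// ltW.
      move: (proj2 (Hu n)) h2; move: (n.+1%:R^-1) => *; lra.
    have : nrm (y - p) <= nrm (y - u n) + nrm (u n - p).
      by have := nrmD (y - u n) (u n - p); rewrite addrA subrK.
    lra.
  rewrite -(@ler_pXn2r _ 2) ?nnegrE ?nrm_ge0 ?sqrtr_ge0//.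
  by rewrite sqr_nrm sqr_sqrtr.
move=> e /dl [m Hm]; exists m => z /Hm; lra.
Qed.

Definition subspace (H : V -> Prop) : Prop :=
  H 0 /\ forall a x y, H x -> H y -> H (a *: x + y).

(** The nested sequence is taken constant; minimality of [p] along the lines p + tw forces
    orthogonality. *)
Lemma projection (H : V -> Prop) y : subspace H -> closed_set H ->
  exists2 p, H p & forall w, H w -> f (y - p) w = 0.
Proof.
move=> [H0 HD] Hcl.
have [p Hp pmin] := @nested_nearest (fun=> H) y (f y y) (fun _ _ => id)
  (fun _ x z Hx Hz => ltac:(rewrite scalerDr -[X in _ + X]addr0;
     exact: HD Hx (HD _ _ _ Hz H0))) (fun=> Hcl)
  (fun=> ltac:(exists 0; rewrite ?subr0//)).
have {}Hp := Hp 0%N.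
exists p => // w Hw; apply/eqP; rewrite -oppr_eq0; apply/eqP.
apply: (@quad_ge0 _ (f w w)) => t.
have : f (y - p) (y - p) <= f (y - (t *: w + p)) (y - (t *: w + p)).
  apply/ler_addgt0Pr => e /pmin [_]; apply; exact: HD.
have -> : y - (t *: w + p) = y - p - t *: w by rewrite opprD addrCA addrC.
move: (y - p) => r; rewrite !fE (fC w r); lra.
Qed.

(** For nonzero [g], the representing vector is a multiple of the component of some [x0] orthogonal
    to the kernel, which is closed because [g] is bounded. *)
Lemma riesz (g : V -> R) (M : R) :
  (forall a x y, g (a *: x + y) = a * g x + g y) ->
  (forall x, `|g x| <= M * nrm x) ->
  exists v, forall x, g x = f x v.
Proof.
move=> glin gb.
have g0 : g 0 = 0.
  by apply/eqP; rewrite -normr_le0; have := gb 0; rewrite nrm0 mulr0.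
have gZ a x : g (a *: x) = a * g x by rewrite -[_ *: _]addr0 glin g0 addr0.
have gD x y : g (x + y) = g x + g y by rewrite -[x]scale1r glin mul1r scale1r.
have gN x : g (- x) = - g x by rewrite -scaleN1r gZ mulN1r.
have M1 : 0 < `|M| + 1 by rewrite ltr_wpDl.
have Kcl : closed_set (fun x => g x = 0).
  move=> x h; apply/eqP; rewrite -normr_le0.
  apply: (@le_of_le_eps _ _ (`|M| + 1)); first exact: ltW.
  move=> e e0 _; have [z gz hz] := h e e0.
  rewrite add0r -[x](subrK z) gD gz addr0.
  apply: le_trans (gb _) _.
  have := ler_norm M; have := nrm_ge0 (x - z); nra.
have Ksub : subspace (fun x => g x = 0).
  by split=> // a x y hx hy; rewrite glin hx hy mulr0 addr0.
case: (pselect (forall x, g x = 0)) => [gz|].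
  by exists 0 => x; rewrite gz f0r.
move/existsNP => [x0 /eqP gx0].
have [p gp horth] := @projection _ x0 Ksub Kcl.
pose q := x0 - p.
have gq : g q = g x0 by rewrite gD gN gp subr0.
have q0 : f q q != 0.
  by apply/eqP => /fxx_eq0 q0; move: gx0; rewrite -gq q0 g0 eqxx.
exists ((g q / f q q) *: q) => x.
rewrite fZr; have : f q (x - (g x / g q) *: q) = 0.
  by apply: horth; rewrite gD gN gZ mulfVK ?gq// subrr.
rewrite fDr fNr fZr => /eqP; rewrite subr_eq0 => /eqP h.
rewrite fC h; field; by rewrite q0 gq gx0.
Qed.

Lemma adjoint_exists (T : V -> V) : linear T -> bounded T ->
  exists B, adjoint T B.
Proof.
move=> Tl [M M0 Tb].
suff : forall y, exists v, forall x, f (T x) y = f x v.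
  by move/choice => [B HB]; exists B.
move=> y; apply: (@riesz (fun x => f (T x) y) (M * nrm y)).
  by move=> a x z; rewrite Tl fDl fZl.
have h x : f (T x) y <= M * nrm y * nrm x.
  apply: le_trans (cauchy_schwarz _ _) _.
  by rewrite mulrAC ler_wpM2r ?nrm_ge0.
move=> x; rewrite ler_norml h andbT lerNl -fNl.
rewrite -scaleN1r -linZ// scaleN1r.
by rewrite -(nrmN x).
Qed.

End RealInnerProduct.

(** * Log-convex sequences *)

Section LogConvex.
Variables (R : realType) (a : nat -> R).
Hypothesis a_ge0 : forall j, 0 <= a j.
Hypothesis a_lc : forall j, a j.+1 ^+ 2 <= a j.+2 * a j.

Lemma bernoulli (t : R) j : 0 <= t -> 1 + j%:R * t <= (1 + t) ^+ j.
Proof.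
move=> t0; elim: j => [|j IHj]; first by rewrite mul0r addr0 expr0.
rewrite exprS -natr1; apply: le_trans (ler_wpM2l _ IHj); last lra.
have : 0 <= j%:R * t * t by rewrite !mulr_ge0.
lra.
Qed.

(** The ratios of consecutive terms increase; the form without division allows zero terms. *)
Lemma logconvex_slope n : a 1 * a n <= a 0 * a n.+1.
Proof.
elim: n => [|n IHn]; first by rewrite mulrC.
have [->|an0] := eqVneq (a n.+1) 0; first by rewrite mulr0 mulr_ge0.
have an : 0 < a n.+1 by rewrite lt0r an0 a_ge0.
rewrite -(ler_pM2r an) -mulrA -expr2.
apply: le_trans (ler_wpM2l (a_ge0 1) (a_lc n)) _.
rewrite mulrCA mulrAC (mulrC (a 0 * _)); exact: ler_wpM2l.
Qed.

Lemma logconvex_interpolation n : a 1 ^+ n.+1 <= a 0 ^+ n * a n.+1.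
Proof.
elim: n => [|n IHn]; first by rewrite expr1 expr0 mul1r.
rewrite exprS; apply: le_trans (ler_wpM2l (a_ge0 1) IHn) _.
rewrite mulrCA exprSr -mulrA; apply: ler_wpM2l; first exact: exprn_ge0.
exact: logconvex_slope.
Qed.

(** If the first ratio exceeded [r], so would the later ones, and [a j] would outgrow [C * r ^+ j];
    Bernoulli's inequality makes this quantitative. *)
Lemma logconvex_bounded (C r : R) : 0 <= r ->
  (forall j, a j <= C * r ^+ j) -> a 1 <= r * a 0.
Proof.
move=> r0 aC; rewrite leNgt; apply/negP => lt1.
have a1 : 0 < a 1 by apply: le_lt_trans lt1; rewrite mulr_ge0.
have [r00|rn0] := eqVneq r 0.
  by have := aC 1%N; rewrite r00 expr1 mulr0 leNgt a1.
have rp : 0 < r by rewrite lt0r rn0.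
have a0 : 0 < a 0.
  rewrite lt0r a_ge0 andbT; apply/eqP => a0.
  by have := a_lc 0; rewrite a0 mulr0 leNgt exprn_gt0.
have ge j : a 1 ^+ j * a 0 <= a 0 ^+ j * a j.
  case: j => [|j]; first by rewrite !expr0.
  by rewrite [a 0 ^+ _]exprS -mulrA mulrC ler_pM2l// logconvex_interpolation.
(* [1 + t] is the factor by which the first ratio exceeds [r]. *)
pose t := a 1 / (r * a 0) - 1.
have ra0 : 0 < r * a 0 by rewrite mulr_gt0.
have t0 : 0 < t by rewrite subr_gt0 ltr_pdivlMr// mul1r.
have a1E : a 1 = (1 + t) * (r * a 0) by rewrite addrC subrK divfK// gt_eqF.
have bd j : (1 + t) ^+ j * a 0 <= C.
  have : (1 + t) ^+ j * a 0 * (r * a 0) ^+ j <= C * (r * a 0) ^+ j.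
    rewrite mulrAC -exprMn -a1E; apply: le_trans (ge j) _.
    by rewrite exprMn mulrA (mulrC (a 0 ^+ j)) ler_pM2r ?exprn_gt0.
  by rewrite ler_pM2r // exprn_gt0.
pose j := Num.bound (C / (a 0 * t)).
have at0 : 0 < a 0 * t by rewrite mulr_gt0.
have hC : 0 <= C.
  by apply: le_trans (bd 0%N); rewrite expr0 mul1r ltW.
have : C / (a 0 * t) < j%:R by apply: archi_boundP; rewrite divr_ge0 // ltW.
rewrite ltr_pdivrMr// => Cj.
have := bd j; have := bernoulli j (ltW t0).
rewrite -(ler_pM2r a0) => h1 h2; have := le_trans h1 h2; lra.
Qed.

(** A strict decrease propagates backwards to the start of the sequence, so a later term that is at
    least [a 0] cannot be followed by a smaller one. The index [j.+1] matters: [a 0] itself may be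
    followed by a smaller term. *)
Lemma logconvex_growth j : a 0 <= a j.+1 -> a j.+1 <= a j.+2.
Proof.
move=> h; rewrite leNgt; apply/negP => lt2.
have step i : a i.+2 < a i.+1 -> a i.+1 < a i.
  move=> lti; rewrite ltNge; apply/negP => le.
  have p1 : 0 < a i.+1 by apply: le_lt_trans lti.
  have := le_trans (a_lc i) (ler_wpM2l (a_ge0 i.+2) le).
  by rewrite expr2 ler_pM2r// leNgt lti.
suff lt0 : a j.+1 < a 0 by move: h; rewrite leNgt lt0.
elim: j {h} lt2 => [|j IHj] /step // lt; exact: lt_trans lt (IHj lt).
Qed.

End LogConvex.

(** * Growth subspaces of a normal operator and their orthogonal complements *)

Section SpectralSubspaces.
Variables (R : realType) (V : lmodType R) (f : V -> V -> R).
Hypothesis Hf : real_ip f.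
Hypothesis Hc : complete_nrm f.
Local Notation nrm := (rnorm f).

Lemma adjoint_linear A B : adjoint f A B -> linear B.
Proof.
move=> AB a x y; apply: (eq_of_f Hf) => z.
by rewrite -AB fDr// fZr// fDr// fZr// !AB.
Qed.

Lemma adjoint_sym A B : adjoint f A B -> adjoint f B A.
Proof. by move=> AB x y; rewrite fC// -AB fC. Qed.

Lemma adjoint_iter A B m : adjoint f A B -> adjoint f (iter m A) (iter m B).
Proof. by move=> AB; elim: m => [|m IHm] x y //=; rewrite AB IHm -iterSr. Qed.

(** Since |Bx|^2 = <ABx, x>, a bound for [A] at the single vector [B x] is enough, so the estimate
    can be used on an invariant subspace. *)
Lemma nrm_adjoint_le A B (M : R) x : adjoint f A B -> 0 <= M ->
  nrm (A (B x)) <= M * nrm (B x) -> nrm (B x) <= M * nrm x.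
Proof.
move=> AB M0 h; have [->|b0] := eqVneq (nrm (B x)) 0.
  by rewrite mulr_ge0// nrm_ge0.
have bp : 0 < nrm (B x) by rewrite lt0r b0 nrm_ge0.
rewrite -(ler_pM2r bp) -expr2 sqr_nrm// -AB.
apply: le_trans (cauchy_schwarz Hf _ _) _.
by rewrite mulrAC ler_wpM2r ?nrm_ge0.
Qed.

Lemma adjoint_bounded A B : adjoint f A B -> bounded f A -> bounded f B.
Proof. by move=> AB [M M0 h]; exists M => // x; exact: nrm_adjoint_le AB M0 (h _). Qed.

Lemma bounded_iter A m : bounded f A -> bounded f (iter m A).
Proof.
move=> [M M0 h]; exists (M ^+ m) => [|x]; first exact: exprn_ge0.
elim: m => [|m IHm]; first by rewrite expr0 mul1r.
by rewrite exprS -mulrA; apply: le_trans (h _) (ler_wpM2l M0 IHm).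
Qed.

Lemma bounded_close A x e : linear A -> bounded f A -> 0 < e ->
  exists2 d, 0 < d & forall z, nrm (x - z) < d -> `|nrm (A x) - nrm (A z)| < e.
Proof.
move=> Al [M M0 h] e0; have M1 : 0 < M + 1 by lra.
exists (e / (M + 1)); first exact: divr_gt0.
move=> z; rewrite ltr_pdivlMr// => hz.
have h1 := nrm_subl Hf (A x) (A z); have h2 := nrm_subl Hf (A z) (A x).
move: h1 h2; rewrite (nrmB Hf (A z)) -linB// => h1 h2.
have h3 := h (x - z); have := nrm_ge0 f (x - z) => h4.
rewrite ltr_norml; apply/andP; split; nra.
Qed.

Definition paran (T : V -> V) : Prop :=
  forall x, nrm (T x) ^+ 2 <= nrm (T (T x)) * nrm x.

(* For a normal [N] this is the spectral subspace of [N^* N] for [0, r^2]. *)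
Definition sublevel (N : V -> V) (r : R) (x : V) : Prop :=
  exists C, forall m, nrm (iter m N x) <= C * r ^+ m.

(** Comparing norms, instead of asking that [S] commute with [N], also covers the adjoint of a root
    of [N]. *)
Lemma sublevel_inv N r S K : 0 <= r ->
  (forall m x, nrm (iter m N (S x)) <= K * nrm (iter m N x)) ->
  forall x, sublevel N r x -> sublevel N r (S x).
Proof.
move=> r0 h x [C hC]; exists (`|K| * C) => m.
apply: le_trans (h _ _) _; rewrite -mulrA.
apply: (@le_trans _ _ (`|K| * nrm (iter m N x))).
  by rewrite ler_wpM2r ?nrm_ge0// ler_norm.
by rewrite ler_wpM2l.
Qed.

(** The unspecified constant improves to |x|, because log-convexity along the orbit bounds every
    consecutive ratio by [r]. *)
Lemma sublevel_le N r x : paran N -> 0 <= r -> sublevel N r x ->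
  forall m, nrm (iter m N x) <= r ^+ m * nrm x.
Proof.
move=> Np r0 [C hC].
have step j : nrm (N (iter j N x)) <= r * nrm (iter j N x).
  apply: (@logconvex_bounded _ (fun i => nrm (iter i N (iter j N x)))
     _ _ (C * r ^+ j)) => //=.
  - by move=> i; apply: nrm_ge0.
  - by move=> i; rewrite -iterD -mulrA -exprD addnC.
elim=> [|m IHm]; first by rewrite expr0 mul1r.
rewrite exprS -mulrA; exact: le_trans (step m) (ler_wpM2l r0 IHm).
Qed.

Lemma sublevel_subspace N r : linear N -> 0 <= r -> subspace (sublevel N r).
Proof.
move=> Nl r0; split.
  by exists 0 => m; rewrite lin0 ?nrm0 ?mul0r//; exact: lin_iter.
move=> a x y [C hC] [D hD]; exists (`|a| * C + D) => m.
rewrite (lin_iter m Nl); apply: le_trans (nrmD Hf _ _) _.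
rewrite mulrDl lerD//; first by rewrite nrmZ// -mulrA ler_wpM2l.
Qed.

(** The constant |z| supplied by [sublevel_le] is continuous in [z], so the growth bound survives
    limits. *)
Lemma sublevel_closed N r : linear N -> bounded f N -> paran N -> 0 <= r ->
  closed_set f (sublevel N r).
Proof.
move=> Nl Nb Np r0 x hx; exists (nrm x) => m; rewrite mulrC.
have Nml := lin_iter m Nl; have [M M0 hM] := bounded_iter m Nb.
have rm0 : 0 <= r ^+ m by exact: exprn_ge0.
apply: (@le_of_le_eps _ _ _ (M + r ^+ m)); first exact: addr_ge0.
move=> e e0 _; have [z Hz hz] := hx e e0.
have h1 := nrm_subl Hf (iter m N x) (iter m N z).
have h2 := nrm_subl Hf z x; rewrite (nrmB Hf) in h2.
have h3 := sublevel_le Np r0 Hz m.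
rewrite -linB// in h1; have h4 := hM (x - z).
have h5 := nrm_ge0 f (x - z).
have h6 : M * nrm (x - z) <= M * e by rewrite ler_wpM2l// ltW.
have h7 : r ^+ m * nrm z <= r ^+ m * (e + nrm x) by rewrite ler_wpM2l//; lra.
lra.
Qed.

Section Normal.
Variables N Ns : V -> V.
Hypothesis Nlin : linear N.
Hypothesis Nbd : bounded f N.
Hypothesis Nadj : adjoint f N Ns.
Hypothesis Nnormal : forall x, Ns (N x) = N (Ns x).

Lemma nrm_normal x : nrm (Ns x) = nrm (N x).
Proof.
by congr Num.sqrt; rewrite Nadj Nnormal -(adjoint_sym Nadj).
Qed.

Lemma normal_paran : paran N.
Proof.
move=> x; rewrite sqr_nrm// Nadj -(nrm_normal (N x)) mulrC.
exact: cauchy_schwarz.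
Qed.

Lemma comm_iter m x : N (iter m Ns x) = iter m Ns (N x).
Proof. by elim: m => [|m IHm] //=; rewrite -Nnormal IHm. Qed.

Lemma nrm_normal_iter m x : nrm (iter m Ns x) = nrm (iter m N x).
Proof.
elim: m x => [|m IHm] x //.
rewrite [in RHS]iterS -nrm_normal iterSr IHm; congr nrm.
by elim: m {IHm} => [|m IHm] //=; rewrite IHm Nnormal.
Qed.

(** Riesz representation for the inner product <x, w> + <Bx, Bw>, whose norm is equivalent to the
    original one, yields z = (1 + B^*B)^-1 y in weak form. *)
Lemma resolvent (B : V -> V) y : linear B -> bounded f B ->
  exists z, forall w, f y w = f z w + f (B z) (B w).
Proof.
move=> Bl [M M0 Bb]; pose g x y := f x y + f (B x) (B y).
have Hg : real_ip g.
  split=> [a x z w|x z|x|x].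
  - by rewrite /g Bl !fDl// !fZl//; ring.
  - by rewrite /g fC// (fC Hf (B x)).
  - by rewrite addr_ge0// fxx_ge0.
  - move/eqP; rewrite paddr_eq0 ?fxx_ge0// => /andP[/eqP h _]; exact: fxx_eq0 h.
have le_g x : nrm x <= rnorm g x by rewrite ler_wsqrtr// lerDl fxx_ge0.
have g_le x : rnorm g x <= (1 + M) * nrm x.
  rewrite -(@ler_pXn2r _ 2) ?nnegrE ?nrm_ge0 ?mulr_ge0 ?addr_ge0 ?nrm_ge0//.
  rewrite (sqr_nrm Hg) /g -!(sqr_nrm Hf) exprMn sqrrD expr1n mul1r.
  have := Bb x; have := nrm_ge0 f (B x); have := nrm_ge0 f x => h1 h2 h3.
  have : nrm (B x) ^+ 2 <= M ^+ 2 * nrm x ^+ 2.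
    by rewrite -exprMn ler_pXn2r// ?nnegrE// mulr_ge0.
  have : 0 <= M * nrm x ^+ 2 by rewrite mulr_ge0// sqr_ge0.
  nra.
have gc : complete_nrm g.
  move=> u hu; have [|l hl] := Hc (u := u).
    move=> e /hu [n hn]; exists n => i j ni nj.
    exact: le_lt_trans (le_g _) (hn _ _ ni nj).
  exists l => e e0; have M1 : 0 < 1 + M by lra.
  have [n hn] := hl _ (divr_gt0 e0 M1); exists n => i /hn.
  by rewrite ltr_pdivlMr// mulrC; exact: le_lt_trans.
have [|x|z hz] := riesz Hg gc (g := f y) (M := nrm y).
- by move=> a x z; rewrite fDr// fZr.
- have h x' : f y x' <= nrm y * rnorm g x'.
    apply: le_trans (cauchy_schwarz Hf _ _) _.
    by rewrite ler_wpM2l ?nrm_ge0.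
  by rewrite ler_norml h andbT lerNl -fNr// -(nrmN Hg).
- by exists z => w; rewrite hz (fC Hg).
Qed.

(* The resolvent z = (1 + N^*m N^m)^-1 y approximates the projection of y on
   [sublevel N 1], here 0, so that y is close to u = N^*m N^m z; and u is
   expanded by N because |N^j z| is log-convex in j. *)
Lemma orth_sublevel1 y : (forall w, sublevel N 1 w -> f y w = 0) ->
  nrm y <= nrm (N y).
Proof.
(* The sets [C m] decrease by log-convexity, and a point common to all of them lies in
   [sublevel N 1]; hence the limiting nearest point [p] is orthogonal to [y]. *)
move=> orth; pose C m z := nrm z <= nrm y /\ nrm (iter m N z) <= nrm y.
have mid_le (x z : V) (c : R) : nrm x <= c -> nrm z <= c -> nrm (2^-1 *: (x + z)) <= c.
  move=> hx hz; rewrite nrmZ// ger0_norm ?invr_ge0//.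
  have := nrmD Hf x z; lra.
have Np := normal_paran.
have lc x : (forall j, 0 <= nrm (iter j N x)) /\ forall j, nrm (iter j.+1 N x) ^+ 2 <=
    nrm (iter j.+2 N x) * nrm (iter j N x).
  by split=> j; [exact: nrm_ge0|exact: Np].
have [||||p Cp pmin] := @nested_nearest _ _ _ Hf Hc C y (f y y).
- move=> m x [hx hm]; split=> //; rewrite leNgt; apply/negP => lt.
  case: m hm lt => [_ /=|m hm lt]; first by rewrite ltNge hx.
  have := logconvex_growth (lc x).1 (lc x).2 (ltW (le_lt_trans hx lt)).
  by rewrite leNgt (le_lt_trans hm lt).
- move=> m x z [hx hmx] [hz hmz]; split; first exact: mid_le.
  have Nm := lin_iter m Nlin.
  by rewrite linZ// linD//; exact: mid_le.
- move=> m x hx; have Nm := lin_iter m Nlin; have [M M0 hM] := bounded_iter m Nbd.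
  split.
    apply: (@le_of_le_eps _ _ _ 1) => // e /hx [z [hz _] xz] _.
    have := nrm_subl Hf x z; lra.
  apply: (@le_of_le_eps _ _ _ M) => // e /hx [z [_ hz] xz] _.
  have := nrm_subl Hf (iter m N x) (iter m N z).
  rewrite -linB//; have := hM (x - z).
  have : M * nrm (x - z) <= M * e by rewrite ler_wpM2l// ltW.
  lra.
- move=> m; exists 0; rewrite ?subr0//; split; rewrite ?nrm0 ?nrm_ge0//.
  by rewrite lin0 ?nrm0 ?nrm_ge0//; exact: lin_iter.
have yp : f y p = 0.
  apply: orth; exists (nrm y) => m; rewrite expr1n mulr1; exact: (Cp m).2.
have [M M0 hM] := Nbd.
apply: (@le_of_le_eps _ _ _ (2 + M)) => [|e e0 _]; first by lra.
have [m hm] := pmin _ (exprn_gt0 2 e0).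
(* The exponent [m.+1] keeps 2(m+1) positive, as [logconvex_growth] requires when it is applied to
   [u] below. *)
pose B := iter m.+1 N.
have Bl : linear B by exact: lin_iter.
have [z hz] := resolvent y Bl (bounded_iter m.+1 Nbd).
have hzz := hz z.
have zy : nrm z ^+ 2 + nrm (B z) ^+ 2 <= nrm y * nrm z.
  by rewrite !sqr_nrm// -hzz cauchy_schwarz.
have y0 := nrm_ge0 f y; have z0 := nrm_ge0 f z; have Bz0 := nrm_ge0 f (B z).
have zle : nrm z <= nrm y.
  rewrite leNgt; apply/negP => lt; nra.
have Bzle : nrm (B z) <= nrm y.
  rewrite -(@ler_pXn2r _ 2) ?nnegrE//; nra.
have Cz : C m z.
  split=> //; rewrite leNgt; apply/negP => lt.
  case: m @B hm Bl hz hzz zy Bz0 Bzle lt => [|m] B hm Bl hz hzz zy Bz0 Bzle lt.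
    by move: lt; rewrite ltNge zle.
  have := logconvex_growth (lc z).1 (lc z).2 (ltW (le_lt_trans zle lt)).
  by rewrite leNgt (le_lt_trans Bzle lt).
(* As [p] is orthogonal to [y] and <y, z> = |z|^2 + |Bz|^2, near-minimality of [p] against [z] reads
   |p|^2 + |z|^2 + 2|Bz|^2 <= e^2. *)
have ze : nrm z <= e.
  rewrite -(@ler_pXn2r _ 2) ?nnegrE// ?(ltW e0)//.
  have := hm z Cz; rewrite !fE// (fC Hf p y) (fC Hf z y) yp hzz -!sqr_nrm//.
  have := sqr_ge0 (nrm p); have := sqr_ge0 (nrm (B z)); lra.
pose u := iter m.+1 Ns (B z).
have yE : y = z + u.
  apply: (eq_of_f Hf) => w; rewrite fC// hz fDr// fC//; congr (_ + _).
  by rewrite fC// (adjoint_iter _ Nadj).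
have uE : nrm u = nrm (iter (m.+1 + m.+1) N z).
  by rewrite /u nrm_normal_iter iterD.
have NuE : nrm (N u) = nrm (iter (m.+1 + m.+1).+1 N z).
  by rewrite /u comm_iter nrm_normal_iter -iterSr /B -iterD addSn.
have yu : nrm y <= nrm z + nrm u by rewrite yE; exact: nrmD.
have Nyu : nrm (N u) <= nrm (N y) + M * nrm z.
  have -> : u = y - z by rewrite yE addrC addKr.
  rewrite linB//; apply: le_trans (nrmD Hf _ _) _.
  by rewrite nrmN// lerD2l hM.
have Mz : M * nrm z <= M * e by rewrite ler_wpM2l.
have Ny0 := nrm_ge0 f (N y).
have Mz0 : 0 <= M * nrm z by rewrite mulr_ge0.
(* If |u| < |z|, then |y| <= 2|z| <= 2e already; otherwise the orbit of [z] has regained its initial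
   size at [u] and cannot shrink afterwards. *)
have [zu|uz] := leP (nrm z) (nrm u); last by lra.
have : nrm u <= nrm (N u).
  rewrite uE NuE addSn.
  by apply: (logconvex_growth (lc z).1 (lc z).2); rewrite -addSn -uE.
lra.
Qed.

End Normal.

(** Rescaling [N] by [r^-1] reduces a positive level to level 1. *)
Lemma orth_sublevel N Ns r y : linear N -> bounded f N -> adjoint f N Ns ->
  (forall x, Ns (N x) = N (Ns x)) -> 0 <= r ->
  (forall w, sublevel N r w -> f y w = 0) -> r * nrm y <= nrm (N y).
Proof.
move=> Nl Nb Na Nn r0 orth; have [->|rn0] := eqVneq r 0.
  by rewrite mul0r nrm_ge0.
have rp : 0 < r by rewrite lt0r rn0.
have rVp : 0 < r^-1 by rewrite invr_gt0.
have Nsl := adjoint_linear Na.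
have iterZ m x : iter m (fun x => r^-1 *: N x) x = r^-1 ^+ m *: iter m N x.
  elim: m => [|m IHm]; first by rewrite expr0 scale1r.
  by rewrite !iterS IHm linZ// scalerA -exprS.
have := @orth_sublevel1 (fun x => r^-1 *: N x) (fun x => r^-1 *: Ns x).
rewrite (_ : (r * nrm y <= _) = (nrm y <= nrm (r^-1 *: N y))); last first.
  by rewrite nrmZ// gtr0_norm// ler_pdivlMl.
apply.
- by move=> a x z; rewrite Nl scalerDr !scalerA mulrC.
- have [M M0 hM] := Nb; exists (r^-1 * M) => [|x]; first by rewrite mulr_ge0// ltW.
  by rewrite nrmZ// gtr0_norm// -mulrA ler_pM2l.
- by move=> x z; rewrite fZl// fZr// Na.
- by move=> x /=; rewrite (linZ _ _ Nsl) (linZ _ _ Nl) Nn.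
- move=> w [C hC]; apply: orth; exists C => m.
  have := hC m; rewrite iterZ nrmZ// expr1n mulr1 gtr0_norm ?exprn_gt0//.
  by rewrite exprVn ler_pdivrMl ?exprn_gt0// mulrC.
Qed.

End SpectralSubspaces.

(** * Normality of a paranormal root of an injective normal operator *)

Section NormalRoots.
Variables (R : realType) (V : lmodType R) (f : V -> V -> R).
Hypothesis Hf : real_ip f.
Hypothesis Hc : complete_nrm f.
Local Notation nrm := (rnorm f).

(** Bernoulli's inequality for the power n+1 of 1 - h/d, cleared of denominators; it converts lower
    bounds for [N] into lower bounds for its root. *)
Lemma bernoulli_sub (d h : R) n : 0 <= h -> h <= d ->
  d ^+ n * (d - n.+1%:R * h) <= (d - h) ^+ n.+1.
Proof.
move=> h0 hd; elim: n => [|n IHn]; first by rewrite expr0 expr1; lra.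
rewrite [leRHS]exprS; apply: le_trans (ler_wpM2l _ IHn); last by lra.
have : 0 <= n.+1%:R * h * h * d ^+ n by rewrite !mulr_ge0 ?exprn_ge0//; lra.
rewrite -subr_ge0 => le; rewrite -subr_ge0; apply: le_trans le _.
by rewrite subr0 exprS -[n.+2%:R]natr1; rewrite le_eqVlt; apply/orP; left; apply/eqP; ring.
Qed.

Lemma sqr_diff_le (d e p q t : R) : 0 <= p -> 0 <= q -> 0 <= t -> 0 <= d -> 0 <= e ->
  p <= d * t -> q <= d * t -> (d - e) * t <= p -> (d - e) * t <= q ->
  `|p ^+ 2 - q ^+ 2| <= 2 * e * d * t ^+ 2.
Proof.
move=> p0 q0 t0 d0 e0 pd qd dp dq.
have -> : p ^+ 2 - q ^+ 2 = (p - q) * (p + q) by ring.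
have -> : 2 * e * d * t ^+ 2 = (e * t) * (d * t + d * t) by ring.
rewrite normrM ler_pM//.
  by rewrite ler_norml; apply/andP; split; lra.
by rewrite ger0_norm ?addr_ge0// lerD.
Qed.

(** Over the reals a vanishing quadratic form only kills symmetric operators: by symmetry its value
    at [x + D x] is 2|Dx|^2. *)
Lemma symmetric_eq0 (D : V -> V) : linear D -> adjoint f D D ->
  (forall x, f (D x) x = 0) -> forall x, D x = 0.
Proof.
move=> Dl Da D0 x; apply: (fxx_eq0 Hf).
have := D0 (x + D x); rewrite linD// !(fDl Hf) !(fDr Hf) !D0 (Da (D x) x); lra.
Qed.

Variables (T Ts : V -> V) (n : nat).
Hypothesis Tlin : linear T.
Hypothesis Tbd : bounded f T.
Hypothesis Tadj : adjoint f T Ts.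
Hypothesis Tparan : paran f T.
Local Notation N := (iter n.+1 T).
Local Notation Ns := (iter n.+1 Ts).
Hypothesis Nnormal : forall x, Ns (N x) = N (Ns x).
Hypothesis Ninj : forall x, N x = 0 -> x = 0.

Let Nlin : linear N := lin_iter n.+1 Tlin.
Let Nbd : bounded f N := bounded_iter n.+1 Tbd.
Let Nadj : adjoint f N Ns := adjoint_iter n.+1 Tadj.
Let Nparan : paran f N := normal_paran Hf Nadj Nnormal.

Lemma iter_iter_comm (A : V -> V) m k x : iter m (iter k A) (A x) = A (iter m (iter k A) x).
Proof. by elim: m => [|m IHm] //=; rewrite IHm -iterSr. Qed.

(** The level is raised to the power [n.+1] so that [d] is on the scale of [T] while the subspace
    belongs to [N]. *)
Let H d x := sublevel f N (d ^+ n.+1) x.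

Lemma root_inv d x : 0 <= d -> H d x -> H d (T x).
Proof.
have [M M0 hM] := Tbd => d0; apply: (sublevel_inv (K := M)); first exact: exprn_ge0.
by move=> m y; rewrite iter_iter_comm.
Qed.

Lemma root_adj_inv d x : 0 <= d -> H d x -> H d (Ts x).
Proof.
have [M M0 hM] := adjoint_bounded Hf Tadj Tbd => d0.
apply: (sublevel_inv (K := M)); first exact: exprn_ge0.
by move=> m y; rewrite -!(nrm_normal_iter Hf Nadj Nnormal) iter_iter_comm.
Qed.

(** Log-convexity of |T^j x| interpolates |Tx|^(n+1) <= |x|^n |Nx|, and |Nx| <= d^(n+1) |x| on this
    subspace. *)
Lemma root_le d x : 0 <= d -> H d x -> nrm (T x) <= d * nrm x.
Proof.
move=> d0 Hx.
rewrite -(@ler_pXn2r _ n.+1) ?nnegrE ?mulr_ge0 ?nrm_ge0//.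
have := @logconvex_interpolation _ (fun j => nrm (iter j T x)) (fun j => nrm_ge0 f _)
  (fun j => Tparan _) n.
move/le_trans; apply; rewrite exprMn [nrm x ^+ n.+1]exprSr mulrCA.
rewrite ler_wpM2l ?exprn_ge0 ?nrm_ge0//.
by have := sublevel_le Nparan (exprn_ge0 _ d0) Hx 1; rewrite expr1.
Qed.

Lemma root_adj_le d x : 0 <= d -> H d x -> nrm (Ts x) <= d * nrm x.
Proof.
move=> d0 Hx; apply: (nrm_adjoint_le Hf Tadj d0).
by apply: root_le => //; exact: root_adj_inv.
Qed.

(** [iter n.+1 S y] arises from [S y] by [n] more applications of [S], each costing a factor at most
    [d], so [S y] carries the lower bound divided by d^n. Here [S] stands for [T] or its adjoint. *)
Lemma root_ge (S : V -> V) d h y : 0 < d -> 0 <= h -> h <= d ->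
  (forall x, H d x -> H d (S x)) -> (forall x, H d x -> nrm (S x) <= d * nrm x) ->
  (d - h) ^+ n.+1 * nrm y <= nrm (iter n.+1 S y) -> H d y ->
  (d - n.+1%:R * h) * nrm y <= nrm (S y).
Proof.
move=> d0 h0 hd SH Sle hy Hy; rewrite -(ler_pM2l (exprn_gt0 n d0)).
rewrite mulrA; apply: le_trans (ler_wpM2r (nrm_ge0 f y) (bernoulli_sub n h0 hd)) _.
apply: le_trans hy _; rewrite iterSr.
suff: forall m x, H d x -> H d (iter m S x) /\ nrm (iter m S x) <= d ^+ m * nrm x.
  by move=> /(_ n _ (SH _ Hy)) [].
move=> m x Hx; elim: m => [|m [IH1 IH2]]; first by rewrite expr0 mul1r.
split; first exact: SH.
rewrite exprS -mulrA; apply: le_trans (Sle _ IH1) _.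
by rewrite ler_pM2l.
Qed.

Lemma normal_root_nrm x : nrm (Ts x) = nrm (T x).
Proof.
have [M M0 hM] : exists2 M, 0 < M & forall y, nrm (T y) <= M * nrm y.
  have [M M0 hM] := Tbd; exists (M + 1) => [|y]; first lra.
  by have := hM y; have := nrm_ge0 f y; lra.
have Tslin := adjoint_linear Hf Tadj.
have defect l : `|nrm (T x) ^+ 2 - nrm (Ts x) ^+ 2| <=
    2 * (n.+1%:R * (M / l.+1%:R)) * M * nrm x ^+ 2.
  set h := M / l.+1%:R.
  have lp : 0 < l.+1%:R :> R by rewrite ltr0n.
  have h0 : 0 < h by exact: divr_gt0.
  have e0 : 0 <= n.+1%:R * h by rewrite mulr_ge0// ltW.
  have hl : l.+1%:R * h = M by rewrite mulrC divfK// gt_eqF.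
  (* The interval from 0 to [M] is cut into [l.+1] slices of width [h]; induction climbs the levels
     [i%:R * h], and level [M] is the whole space because |Ty| <= M |y|. *)
  suff main i y : (i <= l.+1)%N -> H (i%:R * h) y ->
      `|nrm (T y) ^+ 2 - nrm (Ts y) ^+ 2| <= 2 * (n.+1%:R * h) * M * nrm y ^+ 2.
    apply: (main l.+1) => //; rewrite hl; exists (nrm x) => m.
    elim: m => [|m IHm]; first by rewrite mulr1.
    rewrite iterS exprS mulrCA; apply: le_trans (ler_wpM2l (exprn_ge0 _ (ltW M0)) IHm).
    elim: (n.+1) (iter m N x) => [|k IHk] z; first by rewrite mul1r.
    by rewrite iterSr exprSr -mulrA; apply: le_trans (IHk _) _; rewrite ler_pM2l ?exprn_gt0.
  elim: i y => [|i IHi] y il Hy.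
    (* Level 0 is the kernel of [N], which is trivial. *)
    have Ny0 : N y = 0.
      apply: (nrm_eq0 Hf); apply/eqP; rewrite eq_le nrm_ge0 andbT.
      have := sublevel_le Nparan _ Hy 1.
      by rewrite mul0r expr0n /= expr1 mul0r; exact.
    by rewrite (Ninj Ny0) !lin0// nrm0// expr0n /= subr0 mulr0 normr0.
  set d := i.+1%:R * h in Hy.
  have d0 : 0 < d by rewrite mulr_gt0// ltr0n.
  have dh : d - h = i%:R * h by rewrite /d -natr1; ring.
  have hd : h <= d by rewrite -subr_ge0 dh mulr_ge0// ltW.
  have dM : d <= M by rewrite -hl ler_pM2r// ler_nat.
  have ih0 : 0 <= i%:R * h by rewrite -dh subr_ge0.
  have r0 := exprn_ge0 n.+1 ih0.
  have Hsub := sublevel_subspace Hf Nlin r0.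
  have Hcl := sublevel_closed Hf Nlin Nbd Nparan r0.
  (* [p] is the part of [y] below level [d - h], and [q] the part in the slice between [d - h] and
     [d]. *)
  have [p Hp orth] := projection Hf Hc y Hsub Hcl.
  have Hpd : H d p.
    have := sublevel_le Nparan r0 Hp => hp; exists (nrm p) => m.
    apply: le_trans (hp m) _; rewrite mulrC ler_wpM2l ?nrm_ge0//.
    rewrite lerXn2r ?nnegrE ?exprn_ge0 ?(ltW d0)//.
    by rewrite lerXn2r ?nnegrE ?(ltW d0)// -dh lerBlDr lerDl ltW.
  pose q := y - p.
  have Hq : H d q.
    have [_ HD] := sublevel_subspace Hf Nlin (exprn_ge0 n.+1 (ltW d0)).
    by rewrite /q addrC -scaleN1r; exact: HD.
  have yE : y = p + q by rewrite addrC subrK.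
  (* The lower subspace is invariant under T^*T and TT^*, so [T] and its adjoint keep the images of
     [p] and [q] orthogonal, and the defects add by Pythagoras. *)
  have qT : f (T p) (T q) = 0.
    by rewrite fC// Tadj orth//; apply: root_adj_inv => //; exact: root_inv.
  have qTs : f (Ts p) (Ts q) = 0.
    by rewrite -Tadj fC// orth//; apply: root_inv => //; exact: root_adj_inv.
  have qp : f p q = 0 by rewrite fC// orth.
  have Nq : (d - h) ^+ n.+1 * nrm q <= nrm (N q).
    by rewrite dh; apply: (orth_sublevel Hf Hc Nlin Nbd Nadj Nnormal r0).
  have step : `|nrm (T q) ^+ 2 - nrm (Ts q) ^+ 2| <= 2 * (n.+1%:R * h) * M * nrm q ^+ 2.
    apply: (@le_trans _ _ (2 * (n.+1%:R * h) * d * nrm q ^+ 2)); last first.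
      by rewrite ler_wpM2r ?sqr_ge0// ler_wpM2l// mulr_ge0.
    have Td := fun z => @root_inv d z (ltW d0); have Tsd := fun z => @root_adj_inv d z (ltW d0).
    have Tl := fun z => @root_le d z (ltW d0); have Tsl := fun z => @root_adj_le d z (ltW d0).
    apply: sqr_diff_le; rewrite ?nrm_ge0 ?(ltW d0)// ?Tl ?Tsl//.
      exact: root_ge (ltW h0) hd Td Tl Nq Hq.
    (* Since |N^* q| = |N q|, the same lower bound serves the adjoint. *)
    rewrite -(nrm_normal Hf Nadj Nnormal) in Nq.
    exact: root_ge (ltW h0) hd Tsd Tsl Nq Hq.
  have := IHi p (ltnW il) Hp; move: step.
  have -> : nrm (T y) ^+ 2 = nrm (T p) ^+ 2 + nrm (T q) ^+ 2.
    by rewrite !(sqr_nrm Hf) yE linD// pythag.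
  have -> : nrm (Ts y) ^+ 2 = nrm (Ts p) ^+ 2 + nrm (Ts q) ^+ 2.
    by rewrite !(sqr_nrm Hf) yE linD// pythag.
  have -> : nrm y ^+ 2 = nrm p ^+ 2 + nrm q ^+ 2 by rewrite !(sqr_nrm Hf) {1 2}yE pythag.
  rewrite mulrDr opprD addrACA => h1 h2.
  exact: le_trans (ler_normD _ _) (lerD h2 h1).
apply/eqP; rewrite eq_sym -(@eqrXn2 _ 2) ?nrm_ge0// -subr_eq0 -normr_le0.
(* The defect is at most [c / l.+1%:R], which tends to 0 as the slices get thinner. *)
set c := 2 * n.+1%:R * M * M * nrm x ^+ 2.
have c0 : 0 <= c by have M0' := ltW M0; rewrite /c mulr_ge0 ?sqr_ge0// !mulr_ge0.
apply: (@le_of_le_eps _ _ _ c) => // e e0 _; rewrite add0r.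
have [l /(_ l (leqnn l)) hl] := inv_lt e0.
apply: le_trans (defect l) _; apply: le_trans (ler_wpM2l c0 (ltW hl)).
by rewrite /c; rewrite le_eqVlt; apply/orP; left; apply/eqP; ring.
Qed.

(** Equality of the norms says that the symmetric operator T^*T - TT^* has zero quadratic form. *)
Lemma normal_root x : Ts (T x) = T (Ts x).
Proof.
have Tslin := adjoint_linear Hf Tadj; have Tsadj := adjoint_sym Hf Tadj.
apply/eqP; rewrite -subr_eq0; apply/eqP; move: x.
apply: symmetric_eq0 => [a x y|x y|x].
- by rewrite Tlin Tslin Tslin Tlin scalerBr opprD addrACA.
- by rewrite !fE// Tadj !Tsadj Tadj.
- by rewrite !fE// Tadj Tsadj -!sqr_nrm// normal_root_nrm subrr.
Qed.

End NormalRoots.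

(** * Extension of identities and inequalities from a dense range *)

Section DenseRange.
Variables (R : realType) (V : lmodType R) (f : V -> V -> R).
Hypothesis Hf : real_ip f.
Local Notation nrm := (rnorm f).

Definition dense (T : V -> V) : Prop :=
  forall x e, 0 < e -> exists y, nrm (x - T y) < e.

Lemma dense_iter T k : linear T -> bounded f T -> dense T -> dense (iter k T).
Proof.
move=> Tl [M M0 Tb] Td; elim: k => [|k IHk] x e e0.
  by exists x; rewrite subrr nrm0.
have e2 : 0 < e / 2 by rewrite divr_gt0.
have [y hy] := Td x _ e2; have M1 : 0 < M + 1 by lra.
have [z hz] := IHk y _ (divr_gt0 e2 M1); exists z.
have := nrmD Hf (x - T y) (T (y - iter k T z)).
rewrite linB// addrA subrK -linB// => h.
move: hz; rewrite ltr_pdivlMr// => hz.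
have := Tb (y - iter k T z); have := nrm_ge0 f (y - iter k T z); lra.
Qed.

Lemma dense_eq0 (A D : V -> V) : dense A -> linear D -> bounded f D ->
  (forall x, D (A x) = 0) -> forall x, D x = 0.
Proof.
move=> Ad Dl [M M0 Db] DA x; apply: (nrm_eq0 Hf); apply/eqP.
rewrite eq_le nrm_ge0 andbT; apply: (@le_of_le_eps _ _ _ M) => // e e0 _.
have [y hy] := Ad x e e0; rewrite add0r.
have -> : D x = D (x - A y) by rewrite linB// DA subr0.
by apply: le_trans (Db _) _; rewrite ler_wpM2l// ltW.
Qed.

(** The bounded operator A^*A - AA^* vanishes on the range of [A]. *)
Lemma quasinormal_dense A B : linear A -> bounded f A -> adjoint f A B -> dense A ->
  (forall x, B (A (A x)) - A (B (A x)) = 0) -> forall x, B (A x) = A (B x).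
Proof.
move=> Al Ab AB Ad h x; apply/eqP; rewrite -subr_eq0; apply/eqP; move: x.
have Bl := adjoint_linear Hf AB; have Bb := adjoint_bounded Hf AB Ab.
apply: (dense_eq0 Ad) => [a x y||x]; last exact: h.
- by rewrite Al Bl Bl Al scalerBr opprD addrACA.
- have [M M0 hM] := Ab; have [K K0 hK] := Bb.
  exists (K * M + M * K) => [|x]; first by rewrite addr_ge0 ?mulr_ge0.
  apply: le_trans (nrmD Hf _ _) _; rewrite nrmN// mulrDl -!mulrA lerD//.
    exact: le_trans (hK _) (ler_wpM2l K0 (hM _)).
  exact: le_trans (hM _) (ler_wpM2l M0 (hK _)).
Qed.

(** The kernel of a normal operator is that of its adjoint, hence orthogonal to the range. *)
Lemma normal_dense_inj A B : adjoint f A B -> dense A ->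
  (forall x, B (A x) = A (B x)) -> forall x, A x = 0 -> x = 0.
Proof.
move=> AB Ad AN x Ax0; apply: (fxx_eq0 Hf).
have Bx0 : B x = 0 by apply: (nrm_eq0 Hf); rewrite (nrm_normal Hf AB AN) Ax0 nrm0.
apply/eqP; rewrite eq_le fxx_ge0// andbT.
apply: (@le_of_le_eps _ _ _ (nrm x)) => [|e e0 _]; first exact: nrm_ge0.
have [y hy] := Ad x e e0; rewrite add0r.
have -> : f x x = f x (x - A y).
  by rewrite fDr// fNr// (fC Hf x (A y)) AB Bx0 f0r// subr0.
by apply: le_trans (cauchy_schwarz Hf _ _) _; rewrite ler_wpM2l ?nrm_ge0// ltW.
Qed.

Lemma quasiparan_dense T k : linear T -> bounded f T -> dense T ->
  (forall x, nrm (T (iter k T x)) ^+ 2 <= nrm (T (T (iter k T x))) * nrm (iter k T x)) ->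
  paran f T.
Proof.
move=> Tl Tb Td h x.
set a := nrm (T x); set b := nrm (T (T x)); set c := nrm x.
have a0 : 0 <= a := nrm_ge0 f _; have b0 : 0 <= b := nrm_ge0 f _.
have c0 : 0 <= c := nrm_ge0 f _.
(* Expanding (b + e)(c + e) + 2ae and using e^2 <= e gives this coefficient of [e]. *)
apply: (@le_of_le_eps _ _ _ (2 * a + b + c + 1)); first lra.
move=> e e0 e1.
have [d1 d10 hd1] := bounded_close Hf x Tl Tb e0.
have [d2 d20 hd2] := bounded_close Hf x (lin_iter 2 Tl) (bounded_iter 2 Tb) e0.
have d0 : 0 < Num.min e (Num.min d1 d2) by rewrite !lt_min e0 d10.
have [y] := dense_iter k Tl Tb Td x d0.
move: (h y); set z := iter k T y => hz; rewrite !lt_min => /and3P[hz1 hz2 hz3].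
have {hz2} := hd1 _ hz2; have {hz3} := hd2 _ hz3; move: hz hz1 => /=.
have := nrm_subl Hf z x; rewrite (nrmB Hf z x).
have := nrm_ge0 f z; have := nrm_ge0 f (T z); have := nrm_ge0 f (T (T z)).
rewrite -/a -/b -/c !ltr_norml.
move: (nrm (T z)) (nrm (T (T z))) (nrm z) (nrm (x - z)) => a' b' c' s.
move=> b'0 a'0 c'0 h1 h2 h3 /andP[hb1 hb2] /andP[ha1 ha2].
have hbc : b' * c' <= (b + e) * (c + e) by apply: ler_pM => //; lra.
have haa : a ^+ 2 - 2 * a * e <= a' ^+ 2.
  (* Squaring a - e <= a' requires a - e >= 0; otherwise a^2 - 2ae is already nonpositive. *)
  have [ae|ea] := leP e a.
    have : (a - e) ^+ 2 <= a' ^+ 2 by rewrite ler_pXn2r ?nnegrE//; lra.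
    have := sqr_ge0 e; lra.
  apply: (@le_trans _ _ 0); last exact: sqr_ge0.
  have : a * a <= a * e by rewrite ler_wpM2l// ltW.
  have : 0 <= a * e by rewrite mulr_ge0// ltW.
  lra.
have : e * e <= e * 1 by rewrite ler_wpM2l// ltW.
lra.
Qed.

End DenseRange.

(** * Restriction of scalars from [R[i]] to [R], on an alias of [V] that keeps the two module
    structures apart *)

Definition realify (R : rcfType) (V : lmodType R[i]) : Type := V.

Section Realify.
Variables (R : rcfType) (V : lmodType R[i]).
Let scale (a : R) (x : V) : V := real_complex R a *: x.

HB.instance Definition _ := GRing.Zmodule.copy (realify V) V.

Let scaleA a b x : scale a (scale b x) = scale (a * b) x.
Proof. by rewrite /scale scalerA rmorphM. Qed.
Let scale1 : left_id 1 scale.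
Proof. by move=> x; rewrite /scale rmorph1 scale1r. Qed.
Let scaleDr : right_distributive scale +%R.
Proof. by move=> a x y; rewrite /scale scalerDr. Qed.
Let scaleDl x : {morph scale^~ x : a b / a + b}.
Proof. by move=> a b; rewrite /scale rmorphD scalerDl. Qed.

HB.instance Definition _ :=
  GRing.Zmodule_isLmodule.Build R (realify V) scaleA scale1 scaleDr scaleDl.

Lemma realify_scaleE (a : R) (x : realify V) :
  a *: x = (real_complex R a *: (x : V) : V).
Proof. by []. Qed.

End Realify.

(** * Transfer of the real results to complex Hilbert spaces *)

Section Complex.
Variables (R : realType) (V : lmodType R[i]) (ip : V -> V -> R[i]).
Hypothesis HV : hilbert ip.

Let rip (x y : realify V) : R := complex.Re (ip x y).

Lemma real_ip_Re : real_ip rip.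
Proof.
have [[ipl ipC ip0 ipd] _] := HV; split=> [a x y z|x y|x|x h].
- rewrite /rip realify_scaleE ipl; case: (ip x z) (ip y z) => [u v] [u' v'] /=.
  by ring.
- by rewrite /rip ipC; case: (ip y x).
- by have := ip0 x; rewrite /rip lecE => /andP[].
- apply: ipd; move: h (ip0 x); rewrite /rip lecE.
  by case: (ip x x) => u v /= -> /andP[/eqP -> _].
Qed.

(** The norm of the real form unfolds to [ipnorm]. *)
Lemma complete_nrm_Re : complete_nrm rip.
Proof. exact: (proj2 HV). Qed.

Lemma linear_realify (T : V -> V) : linear_op T -> linear (T : realify V -> realify V).
Proof. by move=> Tl a x y; rewrite !realify_scaleE Tl. Qed.

Lemma bounded_realify (T : V -> V) : bounded_op ip T -> bounded rip T.
Proof.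
move=> [_ [M hM]]; exists (Num.max 0 M) => [|x]; first by rewrite le_max lexx.
apply: le_trans (hM x) _; apply: ler_wpM2r; first exact: sqrtr_ge0.
by rewrite le_max lexx orbT.
Qed.

Lemma is_adjoint_realify (A B : V -> V) : is_adjoint ip A B -> adjoint rip A B.
Proof. by move=> AB x y; rewrite /rip AB. Qed.

(** Evaluating the real identity at ix recovers the imaginary parts. *)
Lemma adjoint_complex (A B : V -> V) : linear_op A -> adjoint rip A B -> is_adjoint ip A B.
Proof.
have [[ipl ipC ip0 ipd] _] := HV.
have ipZ a x z : ip (a *: x) z = a * ip x z.
  have ip0l : ip 0 z = 0.
    by apply: (addIr (ip 0 z)); rewrite -[X in X + _ = _]mul1r -ipl scale1r !add0r.
  by rewrite -[_ *: x]addr0 ipl ip0l addr0.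
move=> Al AB x y.
have := AB x y; have := AB ('i%C *: (x : V) : V) y; rewrite /rip linZ// !ipZ.
case: (ip (A x) y) (ip x (B y)) => [u v] [u' v'] /=.
by rewrite !mul0r !mul1r !sub0r => /oppr_inj -> ->.
Qed.

Lemma quasinormal_root_normal (T : V -> V) n : bounded_op ip T -> paranormal ip T ->
  dense_range ip T -> (0 < n)%N -> quasinormal ip (opow T n) -> normal_op ip T.
Proof.
move=> Tb Tp Td; case: n => // n _ [B [AB Bq]].
have Hr := real_ip_Re; have Hc := complete_nrm_Re.
have Tl := linear_realify (proj1 Tb); have Tbr := bounded_realify Tb.
have [Ts Ta] := adjoint_exists Hr Hc Tl Tbr.
have Na := adjoint_iter n.+1 Ta.
have Nl := lin_iter n.+1 Tl; have Nb := bounded_iter n.+1 Tbr.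
have Nd : dense rip (iter n.+1 T) := dense_iter Hr n.+1 Tl Tbr Td.
(* Adjoints are unique, so the one provided by quasinormality is the power of [Ts]. *)
have BE y : B y = iter n.+1 Ts y.
  apply: (eq_of_f Hr) => x; rewrite -Na; symmetry; exact: is_adjoint_realify.
have NN : forall x, iter n.+1 Ts (iter n.+1 T x) = iter n.+1 T (iter n.+1 Ts x).
  apply: (quasinormal_dense Hr Nl Nb Na Nd) => x; rewrite -!BE; exact: Bq.
have Ninj := normal_dense_inj Hr Na Nd NN.
exists Ts; split; first exact: adjoint_complex (proj1 Tb) Ta.
exact: (normal_root Hr Hc Tl Tbr Ta Tp NN Ninj).
Qed.

Lemma normal_quasinormal_pow (T : V -> V) n : normal_op ip T -> quasinormal ip (opow T n).
Proof.
move=> [B [TB BN]]; exists (iter n B); split.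
  rewrite /opow; elim: n => [|n IHn] x y //=; by rewrite TB IHn -iterSr.
have comm1 m x : B (iter m T x) = iter m T (B x).
  by elim: m => [|m IHm] //=; rewrite BN IHm.
have comm m x : iter m B (opow T n x) = opow T n (iter m B x).
  by elim: m => [|m IHm] //=; rewrite IHm comm1.
by move=> x; rewrite comm subrr.
Qed.

(** The adjoints of [T] and [S] are mutually inverse, so inverting the commutation of [S] with its
    adjoint gives that of [T]. *)
Lemma normal_inverse (T S : V -> V) : bounded_op ip T ->
  (forall x, S (T x) = x) -> (forall x, T (S x) = x) -> normal_op ip S -> normal_op ip T.
Proof.
move=> Tb ST TS [C [SC CN]].
have Hr := real_ip_Re; have Hc := complete_nrm_Re.
have Tl := linear_realify (proj1 Tb); have Tbr := bounded_realify Tb.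
have [B Ta] := adjoint_exists Hr Hc Tl Tbr; have SCr := is_adjoint_realify SC.
exists B; split; first exact: adjoint_complex (proj1 Tb) Ta.
have BC y : B (C y) = y by apply: (eq_of_f Hr) => x; rewrite -Ta -SCr ST.
have CB y : C (B y) = y by apply: (eq_of_f Hr) => x; rewrite -SCr -Ta TS.
move=> x; have xE : x = S (C (T (B x))) by rewrite -CN ST CB.
by rewrite {1}xE TS BC.
Qed.

Lemma quasiparanormal_dense (T : V -> V) k : bounded_op ip T -> dense_range ip T ->
  k_quasiparanormal ip k T -> paranormal ip T.
Proof.
move=> Tb Td Tk.
exact: (quasiparan_dense real_ip_Re (linear_realify (proj1 Tb)) (bounded_realify Tb) Td Tk).
Qed.

Lemma surj_dense_range (T S : V -> V) : (forall x, T (S x) = x) -> dense_range ip T.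
Proof.
move=> TS x e e0; exists (S x); rewrite TS subrr.
by rewrite [ipnorm _ _](nrm0 real_ip_Re).
Qed.

End Complex.

(** * The invertible case (a) deduced from the dense-range case (b), since surjective operators have
    dense range *)

Theorem theorem6p7 (R : realType) (V : lmodType R[i]) (ip : V -> V -> R[i])
  (HV : hilbert ip) (T : V -> V) (HT : bounded_op ip T)
  (k : nat) (Hk : (0 < k)%N) (Hkq : k_quasiparanormal ip k T) :
  (forall S : V -> V, is_inverse ip T S ->
     (paranormal ip T /\ paranormal ip S /\
      (forall j : nat, (0 < j)%N ->
         k_quasiparanormal ip j T /\ k_quasiparanormal ip j S)) /\
     (forall n : nat, (0 < n)%N ->
        (quasinormal ip (opow T n) \/ quasinormal ip (opow S n)) ->
        [/\ quasinormal ip (opow T n), quasinormal ip (opow S n),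
            normal_op ip T & normal_op ip S])) /\
  (dense_range ip T ->
     forall n : nat, (0 < n)%N -> quasinormal ip (opow T n) -> normal_op ip T).
Proof.
split=> [S [Sb [ST TS]]|Td n n0 Tq]; last first.
  exact: (quasinormal_root_normal HV HT (quasiparanormal_dense HV HT Td Hkq) Td n0 Tq).
have Td := surj_dense_range HV TS; have Sd := surj_dense_range HV ST.
have Tp := quasiparanormal_dense HV HT Td Hkq.
have Sp : paranormal ip S.
  (* Paranormality of [T] at [S (S x)] reads |Sx|^2 <= |x| |S(Sx)|. *)
  by move=> x; have := Tp (S (S x)); rewrite !TS mulrC.
split.
  by split=> //; split=> // j _; split=> x; [exact: Tp | exact: Sp].
move=> n n0 Q.
have [TN SN] : normal_op ip T /\ normal_op ip S.
  case: Q => [Tq|Sq].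
    have TN := quasinormal_root_normal HV HT Tp Td n0 Tq.
    by split=> //; exact: (normal_inverse HV Sb TS ST TN).
  have SN := quasinormal_root_normal HV Sb Sp Sd n0 Sq.
  by split=> //; exact: (normal_inverse HV HT ST TS SN).
by split=> //; exact: normal_quasinormal_pow.
Qed.
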